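(* Let $k$ be a positive integer and let $q_{n,j}$ ($n\ge1$, $1\le j\le k$) be natural numbers with $$q_{1,1}<q_{1,2}<\cdots<q_{1,k}<q_{2,1}<q_{2,2}<\cdots<q_{2,k}<q_{3,1}<\cdots,$$ such that $q_{n,j}\mid q_{n,j+1}$ for $1\le j\le k-1$ and $q_{n,k}\mid q_{n+1,1}$ for all $n\ge1$, and such that $$\lim_{n\to\infty}\frac{\log q_{n+1,1}-\log q_{n,k}}{\log q_{n+1,k}}=\eta_1,\qquad \lim_{n\to\infty}\frac{\log q_{n+1,i}-\log q_{n+1,i-1}}{\log q_{n+1,k}}=\eta_i\ (2\le i\le k),\qquad \lim_{n\to\infty}\frac{\log q_{n+1,1}}{\log q_{n,k}}=\eta_{k+1}=\infty,$$ where the real numbers $\eta_1,\dots,\eta_k$ satisfy $\eta_1+\eta_2+\cdots+\eta_k=1$ and $\eta_k\ge\eta_{k-1}\ge\cdots\ge\eta_1>0$. Put $\zeta_j=\sum_{n\ge1}\frac{1}{q_{n,j}}$ for $1\le j\le k$. Then the approximation constants of $(\zeta_1,\dots,\zeta_k)$ are $$\omega_1=\infty,\qquad \omega_j=\max_{j-1\le m\le k}\frac{\eta_{m-j+2}}{\eta_1+\eta_2+\cdots+\eta_m}\quad(2\le j\le k+1),$$ $$\widehat\omega_1=\min_{1\le m\le k}\frac{\eta_m}{\eta_1+\eta_2+\cdots+\eta_m},\qquad \widehat\omega_j=0\quad(2\le j\le k+1).$$ (In particular $\omega_2=\max\{\eta_k/(\eta_k+\cdots+\eta_1),\eta_{k-1}/(\eta_{k-1}+\cdots+\eta_1),\dots,\eta_1/\eta_1\}$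 and $\omega_{k+1}=\eta_1/(\eta_k+\cdots+\eta_1)$.)
   Context: For real $\zeta_1,\dots,\zeta_k$, $1\le j\le k+1$ and $X>0$, let $\omega_j(X)$ be the supremum of all real $\nu$ such that the system $|x|\le X$, $|\zeta_ix-y_i|\le X^{-\nu}$ ($1\le i\le k$) has $j$ linearly independent solutions $(x,y_1,\dots,y_k)\in\mathbb{Z}^{k+1}$. Then $\omega_j=\limsup_{X\to\infty}\omega_j(X)$ and $\widehat\omega_j=\liminf_{X\to\infty}\omega_j(X)$; also $\omega=\omega_1$, $\widehat\omega=\widehat\omega_1$. *)

(* Defs.v *)
From Stdlib Require Import Reals ZArith.
From Coquelicot Require Import Coquelicot.
Open Scope R_scope.

Fixpoint zsum (n : nat) (f : nat -> Z) : Z :=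
  match n with O => 0%Z | S m => (zsum m f + f m)%Z end.

Fixpoint psum (f : nat -> R) (m : nat) : R :=
  match m with O => 0 | S m' => psum f m' + f (S m') end.

Fixpoint max_from (f : nat -> R) (a len : nat) : R :=
  match len with O => f a | S l => Rmax (f a) (max_from f (S a) l) end.
Fixpoint min_from (f : nat -> R) (a len : nat) : R :=
  match len with O => f a | S l => Rmin (f a) (min_from f (S a) l) end.

Definition max_range (f : nat -> R) (a b : nat) : R := max_from f a (b - a).
Definition min_range (f : nat -> R) (a b : nat) : R := min_from f a (b - a).

(* A vector of Z^{k+1} is v : nat -> Z with coordinates v 0 = x, v i = y_i (1<=i<=k).
   A family of j vectors is S : nat -> nat -> Z, vectors S 0, ..., S (j-1). *)
Definition lin_indep (j k : nat) (S : nat -> nat -> Z) : Prop :=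
  forall c : nat -> Z,
    (forall t, (t <= k)%nat -> zsum j (fun l => (c l * S l t)%Z) = 0%Z) ->
    forall l, (l < j)%nat -> c l = 0%Z.

Definition approx_sol (k : nat) (zeta : nat -> R) (X nu : R) (v : nat -> Z) : Prop :=
  Rabs (IZR (v O)) <= X /\
  forall i, (1 <= i <= k)%nat ->
    Rabs (zeta i * IZR (v O) - IZR (v i)) <= Rpower X (- nu).

Definition omega_X (k : nat) (zeta : nat -> R) (j : nat) (X : R) : Rbar :=
  Lub_Rbar (fun nu => exists S : nat -> nat -> Z,
    lin_indep j k S /\ forall l, (l < j)%nat -> approx_sol k zeta X nu (S l)).

(* omega_j = limsup_{X -> oo} omega_j(X) = inf_T sup_{X >= T} omega_j(X) *)
Definition omega (k : nat) (zeta : nat -> R) (j : nat) : Rbar :=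
  Rbar_glb (fun u => exists T : R,
    u = Rbar_lub (fun w => exists X : R, T <= X /\ w = omega_X k zeta j X)).

(* hat omega_j = liminf_{X -> oo} omega_j(X) = sup_T inf_{X >= T} omega_j(X) *)
Definition omega_hat (k : nat) (zeta : nat -> R) (j : nat) : Rbar :=
  Rbar_lub (fun u => exists T : R,
    u = Rbar_glb (fun w => exists X : R, T <= X /\ w = omega_X k zeta j X)).

(* Main.v *)
(* Within the scale L = log q_(n+1,k), the denominators q_(n,k) | q_(n+1,1) | ... | q_(n+1,k)
   have logarithms close to sigma_m L with sigma_m = eta_1 + ... + eta_m (m = 0, ..., k), and the
   m-th one approximates all zeta_i with an error about exp(-eta_(m+1) L), the last one with an
   error negligible against every power of q_(n+1,k). These k+1 integer vectors are independent,
   which gives the lower bounds. Conversely, if |x| lies below the (m+1)-st denominator and the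
   error is smaller than exp(-eta_p L), then y_t / x equals the truncation of zeta_t at the index n
   for t > m, and, because the eta_i increase, its truncation at the index n+1 for t <= p. Such
   vectors span a space of dimension at most m - p + 1, so j independent ones force
   p <= m + 1 - j, which gives the upper bounds. *)
Require Import Defs.
From Stdlib Require Import Reals ZArith Lra Lia.
From Coquelicot Require Import Coquelicot.
Open Scope R_scope.

(** * Extended reals and criteria for bounding upper and lower limits *)

Lemma Rbar_lub_ub (E : Rbar -> Prop) x : E x -> Rbar_le x (Rbar_lub E).
Proof. exact (proj1 (proj2_sig (Rbar_ex_lub E)) x). Qed.

Lemma Rbar_lub_least (E : Rbar -> Prop) b :
  (forall x, E x -> Rbar_le x b) -> Rbar_le (Rbar_lub E) b.
Proof. exact (proj2 (proj2_sig (Rbar_ex_lub E)) b). Qed.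

Lemma Rbar_glb_lb (E : Rbar -> Prop) x : E x -> Rbar_le (Rbar_glb E) x.
Proof. exact (proj1 (proj2_sig (Rbar_ex_glb E)) x). Qed.

Lemma Rbar_glb_greatest (E : Rbar -> Prop) b :
  (forall x, E x -> Rbar_le b x) -> Rbar_le b (Rbar_glb E).
Proof. exact (proj2 (proj2_sig (Rbar_ex_glb E)) b). Qed.

Lemma Rbar_le_of_eps (u : Rbar) (a : R) :
  (forall e, 0 < e -> Rbar_le u (a + e)) -> Rbar_le u a.
Proof.
  intros H. destruct u as [u| |]; simpl in *; auto.
  - apply Rnot_lt_le; intros Hu. specialize (H ((u - a) / 2)). lra.
  - exact (H 1 Rlt_0_1).
Qed.

Lemma Rbar_ge_of_eps (u : Rbar) (a : R) :
  (forall e, 0 < e -> Rbar_le (a - e) u) -> Rbar_le a u.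
Proof.
  intros H. destruct u as [u| |]; simpl in *; auto.
  - apply Rnot_lt_le; intros Hu. specialize (H ((a - u) / 2)). lra.
  - exact (H 1 Rlt_0_1).
Qed.

Lemma Rbar_p_infty_of_ge (u : Rbar) : (forall a : R, Rbar_le a u) -> u = p_infty.
Proof.
  intros H. destruct u as [u| |]; auto.
  - specialize (H (u + 1)). simpl in H. lra.
  - destruct (H 0).
Qed.

Lemma omega_le k zeta j (M : Rbar) :
  (exists T, forall X, T <= X -> Rbar_le (omega_X k zeta j X) M) ->
  Rbar_le (omega k zeta j) M.
Proof.
  intros [T H]. eapply Rbar_le_trans.
  - apply Rbar_glb_lb. exists T; reflexivity.
  - apply Rbar_lub_least. intros w [X [HX ->]]. auto.
Qed.

Lemma omega_ge k zeta j (M : Rbar) :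
  (forall T, exists X, T <= X /\ Rbar_le M (omega_X k zeta j X)) ->
  Rbar_le M (omega k zeta j).
Proof.
  intros H. apply Rbar_glb_greatest. intros u [T ->].
  destruct (H T) as [X [HX HM]]. eapply Rbar_le_trans; [exact HM|].
  apply Rbar_lub_ub. exists X; auto.
Qed.

Lemma omega_hat_le k zeta j (M : Rbar) :
  (forall T, exists X, T <= X /\ Rbar_le (omega_X k zeta j X) M) ->
  Rbar_le (omega_hat k zeta j) M.
Proof.
  intros H. apply Rbar_lub_least. intros u [T ->].
  destruct (H T) as [X [HX HM]]. eapply Rbar_le_trans; [|exact HM].
  apply Rbar_glb_lb. exists X; auto.
Qed.

Lemma omega_hat_ge k zeta j (M : Rbar) :
  (exists T, forall X, T <= X -> Rbar_le M (omega_X k zeta j X)) ->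
  Rbar_le M (omega_hat k zeta j).
Proof.
  intros [T H]. eapply Rbar_le_trans.
  2:{ apply Rbar_lub_ub. exists T; reflexivity. }
  apply Rbar_glb_greatest. intros w [X [HX ->]]. auto.
Qed.

Definition admissible (k : nat) (zeta : nat -> R) (j : nat) (X nu : R) : Prop :=
  exists S : nat -> nat -> Z,
    lin_indep j k S /\ forall l, (l < j)%nat -> approx_sol k zeta X nu (S l).

Lemma omega_X_ge k zeta j X nu :
  admissible k zeta j X nu -> Rbar_le nu (omega_X k zeta j X).
Proof. exact (proj1 (Lub_Rbar_correct _) nu). Qed.

Lemma omega_X_le k zeta j X (M : R) :
  (forall nu, M < nu -> ~ admissible k zeta j X nu) -> Rbar_le (omega_X k zeta j X) M.
Proof.
  intros H. apply (proj2 (Lub_Rbar_correct _)). intros nu Hnu. simpl.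
  apply Rnot_lt_le. intros HM. exact (H nu HM Hnu).
Qed.

(** * Maxima and minima over ranges of indices *)

Lemma max_from_ge f len : forall a m, (a <= m <= a + len)%nat -> f m <= max_from f a len.
Proof.
  induction len as [|len IH]; intros a m Hm; simpl.
  - replace m with a by lia. lra.
  - destruct (Nat.eq_dec m a) as [->|Hne]; [apply Rmax_l|].
    eapply Rle_trans; [apply (IH (S a)); lia|apply Rmax_r].
Qed.

Lemma max_from_attained f len : forall a,
  exists m, (a <= m <= a + len)%nat /\ max_from f a len = f m.
Proof.
  induction len as [|len IH]; intros a; simpl.
  - exists a. split; [lia|reflexivity].
  - destruct (IH (S a)) as [m [Hm E]].
    unfold Rmax. destruct (Rle_dec _ _); [exists m|exists a]; split; auto; lia.
Qed.

Lemma max_range_ge f a b m : (a <= m <= b)%nat -> f m <= max_range f a b.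
Proof. intros H. apply max_from_ge. lia. Qed.

Lemma max_range_attained f a b : (a <= b)%nat ->
  exists m, (a <= m <= b)%nat /\ max_range f a b = f m.
Proof.
  intros H. destruct (max_from_attained f (b - a) a) as [m [Hm E]].
  exists m. split; [lia|exact E].
Qed.

Lemma min_from_opp f len : forall a, min_from f a len = - max_from (fun m => - f m) a len.
Proof.
  induction len as [|len IH]; intros a; simpl; [lra|].
  rewrite IH, Ropp_Rmax, Ropp_involutive. reflexivity.
Qed.

Lemma min_range_le f a b m : (a <= m <= b)%nat -> min_range f a b <= f m.
Proof.
  intros H. unfold min_range. rewrite min_from_opp.
  pose proof (max_range_ge (fun m => - f m) a b m H). unfold max_range in *. simpl in *. lra.
Qed.

Lemma min_range_attained f a b : (a <= b)%nat ->
  exists m, (a <= m <= b)%nat /\ min_range f a b = f m.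
Proof.
  intros H. destruct (max_range_attained (fun m => - f m) a b H) as [m [Hm E]].
  exists m. split; [exact Hm|]. unfold min_range. rewrite min_from_opp.
  unfold max_range in E. rewrite E. ring.
Qed.

(** * Linear dependence over the integers *)

Lemma zsum_ext n f g : (forall l, (l < n)%nat -> f l = g l) -> zsum n f = zsum n g.
Proof.
  induction n as [|n IH]; intros H; simpl; [reflexivity|].
  rewrite IH, (H n); auto.
Qed.

Lemma zsum_lin n a b f g :
  zsum n (fun l => (a * f l + b * g l)%Z) = (a * zsum n f + b * zsum n g)%Z.
Proof. induction n as [|n IH]; simpl; [ring|]. rewrite IH. ring. Qed.

Lemma zsum_scal n a f : zsum n (fun l => (a * f l)%Z) = (a * zsum n f)%Z.
Proof. induction n as [|n IH]; simpl; [ring|]. rewrite IH. ring. Qed.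

Lemma zsum_zero n f : (forall l, (l < n)%nat -> f l = 0%Z) -> zsum n f = 0%Z.
Proof.
  induction n as [|n IH]; intros H; simpl; [reflexivity|].
  rewrite IH, (H n); auto.
Qed.

Lemma all_zero_or_nonzero d (f : nat -> Z) :
  (forall u, (u < d)%nat -> f u = 0%Z) \/ exists u, (u < d)%nat /\ f u <> 0%Z.
Proof.
  induction d as [|d [IH|[u [Hu Hf]]]].
  - left. lia.
  - destruct (Z.eq_dec (f d) 0) as [E|E].
    + left. intros u Hu. destruct (Nat.eq_dec u d) as [->|]; auto. apply IH. lia.
    + right. exists d. auto.
  - right. exists u. auto.
Qed.

(* Eliminates a coordinate at which the last vector is nonzero. *)
Lemma integer_dependence : forall j d (w : nat -> nat -> Z), (d < j)%nat ->
  exists c, (exists l, (l < j)%nat /\ c l <> 0%Z) /\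
    forall u, (u < d)%nat -> zsum j (fun l => (c l * w l u)%Z) = 0%Z.
Proof.
  induction j as [|j IH]; intros d w Hd; [lia|].
  destruct (all_zero_or_nonzero d (w j)) as [H0|[u0 [Hu0 Ha]]].
  - exists (fun l => if (l =? j)%nat then 1%Z else 0%Z). split.
    + exists j. rewrite Nat.eqb_refl. split; [lia|discriminate].
    + intros u Hu. simpl. rewrite Nat.eqb_refl, (H0 u Hu), zsum_zero; [ring|].
      intros l Hl. destruct (Nat.eqb_spec l j); [lia|ring].
  - set (a := w j u0) in *.
    set (w' := fun l u => (a * w l u + (- w j u) * w l u0)%Z).
    (* Coordinate [u0] of every [w'] is 0, so the reindexing skips it and the induction runs in
       dimension [d - 1]. *)
    destruct (IH (pred d) (fun l u => w' l (if (u <? u0)%nat then u else S u)))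
      as [c [[l [Hl Hc]] Hz]]; [lia|].
    assert (Hz' : forall u, (u < d)%nat -> zsum j (fun l => (c l * w' l u)%Z) = 0%Z).
    { intros u Hu. destruct (Nat.lt_trichotomy u u0) as [H|[->|H]].
      - specialize (Hz u ltac:(lia)). cbv beta in Hz.
        destruct (Nat.ltb_spec u u0); [exact Hz|lia].
      - apply zsum_zero. intros i _. unfold w', a. ring.
      - specialize (Hz (pred u) ltac:(lia)). cbv beta in Hz.
        destruct (Nat.ltb_spec (pred u) u0); [lia|].
        rewrite (Nat.succ_pred u ltac:(lia)) in Hz. exact Hz. }
    (* The coefficient [- s] of the last vector accounts for all the multiples of [w j] subtracted
       in [w']. *)
    set (s := zsum j (fun l => (c l * w l u0)%Z)).
    exists (fun l => if (l =? j)%nat then (- s)%Z else (a * c l)%Z). split.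
    + exists l. destruct (Nat.eqb_spec l j); [lia|]. split; [lia|].
      intros E. apply Z.mul_eq_0 in E. tauto.
    + intros u Hu. simpl. rewrite Nat.eqb_refl.
      transitivity (zsum j (fun l => (c l * w' l u)%Z)); [|auto].
      rewrite (zsum_ext j (fun l => (c l * w' l u)%Z)
        (fun l => (a * (c l * w l u) + (- w j u) * (c l * w l u0))%Z)).
      2:{ intros i _. unfold w'. ring. }
      rewrite zsum_lin. fold s.
      rewrite (zsum_ext j _ (fun l => (a * (c l * w l u))%Z)).
      2:{ intros i Hi. destruct (Nat.eqb_spec i j); [lia|ring]. }
      rewrite zsum_scal. ring.
Qed.

(** The system is triangular: the suffix sum starting at the last index is the last term alone, and
    removing that term leaves the same system for a shorter family. *)
Lemma suffix_sums_zero j : forall f : nat -> Z,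
  (forall s, (s < j)%nat -> zsum j (fun l => if (s <=? l)%nat then f l else 0%Z) = 0%Z) ->
  forall l, (l < j)%nat -> f l = 0%Z.
Proof.
  induction j as [|j IH]; intros f H; [lia|].
  assert (Hj : f j = 0%Z).
  { specialize (H j ltac:(lia)). simpl in H. rewrite Nat.leb_refl, zsum_zero in H; [lia|].
    intros l Hl. destruct (Nat.leb_spec j l); [lia|reflexivity]. }
  intros l Hl. destruct (Nat.eq_dec l j) as [->|]; [exact Hj|].
  apply (IH f); [|lia]. intros s Hs. specialize (H s ltac:(lia)). simpl in H.
  destruct (Nat.leb_spec s j); [|lia]. lia.
Qed.

(** Each coordinate [t <= p] or [t > m] is a fixed rational multiple of coordinate 0, so a vector is
    determined by coordinate 0 and the coordinates [p < t <= m]. These are [m + 1 - p] numbers,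
    fewer than [j]. *)
Lemma dependent_of_ratios j k m p (S : nat -> nat -> Z) (al be : nat -> Z) :
  (m + 1 < j + p)%nat -> (p <= m)%nat ->
  (forall t, (1 <= t <= p \/ m < t <= k)%nat -> al t <> 0%Z /\
     forall l, (l < j)%nat -> (al t * S l t = be t * S l 0%nat)%Z) ->
  ~ lin_indep j k S.
Proof.
  intros Hj Hpm H Hind.
  destruct (integer_dependence j (m + 1 - p)
    (fun l u => S l (match u with O => O | _ => (p + u)%nat end)))
    as [c [[l [Hl Hc]] Hz]]; [lia|].
  apply Hc. apply (Hind c); [|exact Hl]. clear l Hl Hc. intros t Ht.
  assert (H0 : zsum j (fun l => (c l * S l 0%nat)%Z) = 0%Z) by (apply (Hz 0%nat); lia).
  destruct (Nat.eq_dec t 0) as [->|Ht0]; [exact H0|].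
  assert (D : (p < t <= m)%nat \/ (1 <= t <= p \/ m < t <= k)%nat) by lia.
  destruct D as [D|D].
  - specialize (Hz (t - p)%nat ltac:(lia)). cbv beta in Hz.
    destruct (t - p)%nat as [|u] eqn:E; [lia|].
    replace (p + Datatypes.S u)%nat with t in Hz by lia. exact Hz.
  - destruct (H t D) as [Ha Hr].
    apply (Z.mul_reg_l _ _ (al t) Ha). rewrite Z.mul_0_r, <- zsum_scal.
    rewrite (zsum_ext j _ (fun l => (be t * (c l * S l 0%nat))%Z)).
    + rewrite zsum_scal, H0. ring.
    + intros l Hl. specialize (Hr l Hl).
      replace (al t * (c l * S l t))%Z with (c l * (al t * S l t))%Z by ring.
      rewrite Hr. ring.
Qed.

(** * Small integers, crossings of a level, and the exponent 0 *)

Lemma IZR_lt_1_zero z : Rabs (IZR z) < 1 -> z = 0%Z.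
Proof. intros H. rewrite <- abs_IZR in H. apply lt_IZR in H. lia. Qed.

Lemma crossing (f : nat -> R) a len x :
  f a <= x < f (a + len)%nat ->
  exists m, (a <= m < a + len)%nat /\ f m <= x < f (S m).
Proof.
  induction len as [|len IH]; intros H.
  - rewrite Nat.add_0_r in H. lra.
  - destruct (Rlt_le_dec x (f (a + len)%nat)) as [Hlt|Hle].
    + destruct (IH (conj (proj1 H) Hlt)) as [m [Hm Hf]]. exists m. split; [lia|exact Hf].
    + exists (a + len)%nat. rewrite <- Nat.add_succ_r. split; [lia|lra].
Qed.

Lemma crossing_unbounded (f : nat -> R) a x :
  f a <= x -> (exists b, (a <= b)%nat /\ x < f b) ->
  exists m, (a <= m)%nat /\ f m <= x < f (S m).
Proof.
  intros Ha [b [Hab Hb]]. destruct (crossing f a (b - a) x) as [m [Hm Hf]].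
  - replace (a + (b - a))%nat with b by lia. lra.
  - exists m. split; [lia|exact Hf].
Qed.

(** The vector of 1 and the integer parts of the [zeta t], together with the unit vectors of the
    coordinates [1, ..., k], have errors at most [1 = X^0]. This yields the lower bound 0 for the
    uniform constants. *)
Lemma admissible_zero k zeta j X : (j <= k + 1)%nat -> 1 <= X -> admissible k zeta j X 0.
Proof.
  intros Hj HX.
  exists (fun l t => match l, t with
    | O, O => 1%Z
    | O, _ => Int_part (zeta t)
    | _, _ => if (l =? t)%nat then 1%Z else 0%Z end).
  split.
  - intros c Hc.
    assert (H0 : c 0%nat = 0%Z \/ j = 0%nat).
    { destruct j as [|j]; [auto|left]. specialize (Hc 0%nat ltac:(lia)). clear Hj.
      revert Hc. induction j as [|j IH]; intros Hc; [simpl in Hc; lia|].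
      apply IH. cbn [zsum] in *. cbn in Hc. cbn. lia. }
    intros l Hl. destruct H0 as [H0|H0]; [|lia].
    destruct l as [|l]; [exact H0|].
    specialize (Hc (S l) ltac:(lia)). rewrite <- Hc. clear Hc.
    (* Once [c 0 = 0], coordinate [S l] of the combination only sees the unit vector of index
       [S l]. *)
    assert (G : forall i, zsum i (fun l0 => (c l0 * match l0 with
       | O => Int_part (zeta (S l)) | S _ => if (l0 =? S l)%nat then 1 else 0 end)%Z)
       = if (S l <? i)%nat then c (S l) else 0%Z).
    { induction i as [|i IH]; [reflexivity|]. simpl zsum. rewrite IH.
      destruct (Nat.ltb_spec (S l) i), (Nat.ltb_spec (S l) (S i)); try lia.
      - destruct i; [lia|]. destruct (Nat.eqb_spec (S i) (S l)); [lia|]. ring.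
      - replace i with (S l) by lia. rewrite Nat.eqb_refl. ring.
      - destruct i; [rewrite H0; ring|]. destruct (Nat.eqb_spec (S i) (S l)); [lia|]. ring. }
    rewrite G. destruct (Nat.ltb_spec (S l) j); [reflexivity|lia].
  - intros l Hl. unfold approx_sol, Rpower. rewrite Ropp_0, Rmult_0_l, exp_0.
    destruct l as [|l].
    + rewrite Rabs_R1. split; [exact HX|]. intros [|i] Hi; [lia|].
      pose proof (base_Int_part (zeta (S i))). apply Rabs_le. lra.
    + cbn -[IZR]. rewrite Rabs_R0. split; [lra|]. intros i _. rewrite Rmult_0_r.
      destruct i as [|i]; [|destruct (l =? i)%nat]; apply Rabs_le; lra.
Qed.

Lemma exp_le x y : x <= y -> exp x <= exp y.
Proof. intros [H| ->]; [left; apply exp_increasing, H|right; reflexivity]. Qed.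

(** * Diophantine approximation within one scale *)

Section Scale.

(* One scale of the construction: [Q 0 | Q 1 | ... | Q (k+1)] stands for
   [q_(n,k) | q_(n+1,1) | ... | q_(n+1,k) | q_(n+2,1)], and [N t / Q 0] is the
   partial sum of [zeta t] up to the index [n]. *)
Variables (k : nat) (Q : nat -> nat) (N : nat -> Z) (zeta : nat -> R).
Hypothesis Q_pos : forall i, (i <= S k)%nat -> (0 < Q i)%nat.
Hypothesis Q_div : forall i, (i <= k)%nat -> Nat.divide (Q i) (Q (S i)).
Hypothesis tail0 : forall t, (1 <= t <= k)%nat ->
  Rabs (zeta t - IZR (N t) / INR (Q 0)) <= 2 / INR (Q t).
Hypothesis tail1 : forall t, (1 <= t <= k)%nat ->
  Rabs (zeta t - IZR (N t) / INR (Q 0) - / INR (Q t)) <= 2 / INR (Q (S k)).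

Lemma Q_div_le i j : (i <= j <= S k)%nat -> Nat.divide (Q i) (Q j).
Proof.
  induction j as [|j IH]; intros H; [replace i with 0%nat by lia; apply Nat.divide_refl|].
  destruct (Nat.eq_dec i (S j)) as [->|]; [apply Nat.divide_refl|].
  eapply Nat.divide_trans; [apply IH; lia|apply Q_div; lia].
Qed.

Lemma Q_le i j : (i <= j <= S k)%nat -> (Q i <= Q j)%nat.
Proof.
  intros H. apply Nat.divide_pos_le; [apply Q_pos; lia|apply Q_div_le; lia].
Qed.

Lemma Q_posR i : (i <= S k)%nat -> 0 < INR (Q i).
Proof. intros H. apply lt_0_INR, Q_pos, H. Qed.

Lemma Q_inv_le i j : (i <= j <= S k)%nat -> / INR (Q j) <= / INR (Q i).
Proof.
  intros H. apply Rinv_le_contravar; [apply Q_posR; lia|apply le_INR, Q_le; lia].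
Qed.

Definition quo (i j : nat) : Z := Z.of_nat (Q j / Q i).

Lemma quo_spec i j : (i <= j <= S k)%nat -> (quo i j * Z.of_nat (Q i) = Z.of_nat (Q j))%Z.
Proof.
  intros H. destruct (Q_div_le i j H) as [c E]. pose proof (Q_pos i ltac:(lia)).
  unfold quo. rewrite E, Nat.div_mul by lia. lia.
Qed.

Lemma quo_pos i j : (i <= j <= S k)%nat -> (0 < quo i j)%Z.
Proof.
  intros H. pose proof (quo_spec i j H). pose proof (Q_pos i ltac:(lia)).
  pose proof (Q_pos j ltac:(lia)). nia.
Qed.

Lemma quo_trans i j l : (i <= j <= l)%nat -> (l <= S k)%nat ->
  (quo i l = quo i j * quo j l)%Z.
Proof.
  intros H Hl. pose proof (Q_pos i ltac:(lia)).
  apply (Z.mul_reg_r _ _ (Z.of_nat (Q i))); [lia|].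
  rewrite quo_spec by lia.
  rewrite <- (quo_spec j l) by lia. rewrite <- (quo_spec i j) by lia. ring.
Qed.

Lemma quo_refl : quo 0 0 = 1%Z.
Proof. pose proof (Q_pos 0 ltac:(lia)). unfold quo. rewrite Nat.div_same by lia. reflexivity. Qed.

Lemma quo_R i j : (i <= j <= S k)%nat -> IZR (quo i j) = INR (Q j) / INR (Q i).
Proof.
  intros H. pose proof (Q_posR i ltac:(lia)).
  rewrite (INR_IZR_INZ (Q j)), <- (quo_spec i j H), mult_IZR, <- INR_IZR_INZ.
  field. lra.
Qed.

(** Replacing [zeta t] by [N t / Q 0] costs at most [2 / Q t] per unit of [v 0]. Multiplied by
    [Q 0], the resulting error is an integer, and the last hypothesis makes it smaller than 1. *)
Lemma tail_zero t eps X (v : nat -> Z) : (1 <= t <= k)%nat ->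
  Rabs (IZR (v 0%nat)) <= X -> Rabs (zeta t * IZR (v 0%nat) - IZR (v t)) <= eps ->
  INR (Q 0) * (eps + 2 * X / INR (Q t)) < 1 ->
  (N t * v 0%nat = Z.of_nat (Q 0) * v t)%Z.
Proof.
  intros Ht HX He Hlt. pose proof (Q_posR 0 ltac:(lia)) as Hr.
  pose proof (Q_posR t ltac:(lia)) as Hq.
  enough (N t * v 0%nat - Z.of_nat (Q 0) * v t = 0)%Z by lia.
  apply IZR_lt_1_zero. rewrite minus_IZR, !mult_IZR, <- INR_IZR_INZ.
  eapply Rle_lt_trans; [|exact Hlt].
  replace (IZR (N t) * IZR (v 0%nat) - INR (Q 0) * IZR (v t)) with
    (INR (Q 0) * ((zeta t * IZR (v 0%nat) - IZR (v t))
      + - ((zeta t - IZR (N t) / INR (Q 0)) * IZR (v 0%nat)))) by (field; lra).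
  rewrite Rabs_mult, (Rabs_pos_eq (INR (Q 0))) by lra.
  apply Rmult_le_compat_l; [lra|]. eapply Rle_trans; [apply Rabs_triang|].
  apply Rplus_le_compat; [exact He|]. rewrite Rabs_Ropp, Rabs_mult.
  replace (2 * X / INR (Q t)) with (2 / INR (Q t) * X) by (field; lra).
  apply Rmult_le_compat; auto using Rabs_pos.
Qed.

(** The integer is [Q t] times [(N t / Q 0 + 1 / Q t) * v 0 - v t], the error of [v] against the
    next partial sum of [zeta t]. That partial sum differs from [zeta t] by at most
    [2 / Q (k+1)]. *)
Lemma head_bound t eps X (v : nat -> Z) : (1 <= t <= k)%nat ->
  Rabs (IZR (v 0%nat)) <= X -> Rabs (zeta t * IZR (v 0%nat) - IZR (v t)) <= eps ->
  Rabs (IZR (quo 0 t * (N t * v 0%nat - Z.of_nat (Q 0) * v t) + v 0%nat)%Z)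
    <= INR (Q t) * (eps + 2 * X / INR (Q (S k))).
Proof.
  intros Ht HX He. pose proof (Q_posR 0 ltac:(lia)) as Hr.
  pose proof (Q_posR t ltac:(lia)) as Hq. pose proof (Q_posR (S k) ltac:(lia)) as Hq'.
  rewrite plus_IZR, mult_IZR, minus_IZR, !mult_IZR, <- INR_IZR_INZ, quo_R by lia.
  replace (INR (Q t) / INR (Q 0) * (IZR (N t) * IZR (v 0%nat) - INR (Q 0) * IZR (v t))
    + IZR (v 0%nat)) with
    (INR (Q t) * ((zeta t * IZR (v 0%nat) - IZR (v t))
      + - ((zeta t - IZR (N t) / INR (Q 0) - / INR (Q t)) * IZR (v 0%nat))))
    by (field; lra).
  rewrite Rabs_mult, (Rabs_pos_eq (INR (Q t))) by lra.
  apply Rmult_le_compat_l; [lra|]. eapply Rle_trans; [apply Rabs_triang|].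
  apply Rplus_le_compat; [exact He|]. rewrite Rabs_Ropp, Rabs_mult.
  replace (2 * X / INR (Q (S k))) with (2 / INR (Q (S k)) * X) by (field; lra).
  apply Rmult_le_compat; auto using Rabs_pos.
Qed.

(* The integer on the left is divisible by [quo 0 (t-1)], since the vanishing for [t-1]
   makes [v 0] divisible by it, and too small to be a nonzero multiple. *)
Lemma head_zero p eps X (v : nat -> Z) : (p <= k)%nat ->
  Rabs (IZR (v 0%nat)) <= X ->
  (forall t, (1 <= t <= k)%nat -> Rabs (zeta t * IZR (v 0%nat) - IZR (v t)) <= eps) ->
  (forall t, (1 <= t <= p)%nat ->
     INR (Q t) * (eps + 2 * X / INR (Q (S k))) < INR (Q (pred t)) / INR (Q 0)) ->
  forall t, (1 <= t <= p)%nat ->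
    (quo 0 t * (N t * v 0%nat - Z.of_nat (Q 0) * v t) + v 0%nat = 0)%Z.
Proof.
  intros Hp HX He Hs.
  assert (G : forall t, (t <= p)%nat -> Z.divide (quo 0 t) (v 0%nat) /\
    ((1 <= t)%nat -> (quo 0 t * (N t * v 0%nat - Z.of_nat (Q 0) * v t) + v 0%nat = 0)%Z)).
  2:{ intros t Ht. apply G; lia. }
  induction t as [|t IH]; intros Ht.
  - split; [rewrite quo_refl; apply Z.divide_1_l|lia].
  - destruct (IH ltac:(lia)) as [Hd _].
    set (g := (quo 0 (S t) * (N (S t) * v 0%nat - Z.of_nat (Q 0) * v (S t)) + v 0%nat)%Z).
    assert (Hg : g = 0%Z).
    { assert (D : Z.divide (quo 0 t) g).
      { apply Z.divide_add_r; [|exact Hd]. apply Z.divide_mul_l.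
        rewrite (quo_trans 0 t (S t)) by lia. apply Z.divide_factor_l. }
      pose proof (head_bound (S t) eps X v ltac:(lia) HX (He (S t) ltac:(lia))) as B.
      fold g in B. specialize (Hs (S t) ltac:(lia)). simpl pred in Hs.
      rewrite <- quo_R in Hs by lia. rewrite <- abs_IZR in B.
      assert (Z.abs g < quo 0 t)%Z by (apply lt_IZR; lra).
      destruct D as [c E]. pose proof (quo_pos 0 t ltac:(lia)).
      destruct (Z.eq_dec c 0) as [->|]; [lia|]. rewrite E, Z.abs_mul in H.
      rewrite (Z.abs_eq (quo 0 t)) in H by lia. assert (1 <= Z.abs c)%Z by lia. nia. }
    split; [|intros _; exact Hg].
    exists (- (N (S t) * v 0%nat - Z.of_nat (Q 0) * v (S t)))%Z.
    unfold g in Hg. lia.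
Qed.

(** The first smallness condition ties the coordinates [t > m] to coordinate 0 through [N t / Q 0],
    the second ties the coordinates [t <= p] through the next partial sum. *)
Lemma dependent_of_small j m p eps X (S : nat -> nat -> Z) :
  (m <= k)%nat -> (p <= m)%nat -> (m + 1 < j + p)%nat ->
  (forall l, (l < j)%nat -> Rabs (IZR (S l 0%nat)) <= X /\
     forall t, (1 <= t <= k)%nat -> Rabs (zeta t * IZR (S l 0%nat) - IZR (S l t)) <= eps) ->
  (forall t, (m < t <= k)%nat -> INR (Q 0) * (eps + 2 * X / INR (Q t)) < 1) ->
  (forall t, (1 <= t <= p)%nat ->
     INR (Q t) * (eps + 2 * X / INR (Q (Datatypes.S k))) < INR (Q (pred t)) / INR (Q 0)) ->
  ~ lin_indep j k S.
Proof.
  intros Hm Hpm Hj Hv Ht Hh. pose proof (Q_pos 0 ltac:(lia)) as HQ0.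
  apply (dependent_of_ratios j k m p S
    (* These are the denominators and numerators of the two partial sums: [quo 0 t * Q 0] is [Q t],
       and [(quo 0 t * N t + 1) / Q t] is [N t / Q 0 + 1 / Q t]. *)
    (fun t => if (t <=? p)%nat then (quo 0 t * Z.of_nat (Q 0))%Z else Z.of_nat (Q 0))
    (fun t => if (t <=? p)%nat then (quo 0 t * N t + 1)%Z else N t)); auto.
  intros t Htt. destruct (Nat.leb_spec t p) as [Htp|Htp].
  - rewrite quo_spec by lia. pose proof (Q_pos t ltac:(lia)). split; [lia|].
    intros l Hl. destruct (Hv l Hl) as [HX He].
    pose proof (head_zero p eps X (S l) ltac:(lia) HX He Hh t ltac:(lia)).
    rewrite <- (quo_spec 0 t) by lia. lia.
  - split; [lia|]. intros l Hl. destruct (Hv l Hl) as [HX He].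
    symmetry. apply (tail_zero t eps X (S l)); [lia|exact HX|apply He; lia|apply Ht; lia].
Qed.

(** Coordinate [m + 1] falls under both conditions, so it equals [v 0] times two distinct partial
    sums. Hence [v 0 = 0], and all other coordinates vanish with it. *)
Lemma zero_of_small m eps X (v : nat -> Z) : (m < k)%nat ->
  Rabs (IZR (v 0%nat)) <= X ->
  (forall t, (1 <= t <= k)%nat -> Rabs (zeta t * IZR (v 0%nat) - IZR (v t)) <= eps) ->
  (forall t, (m < t <= k)%nat -> INR (Q 0) * (eps + 2 * X / INR (Q t)) < 1) ->
  (forall t, (1 <= t <= S m)%nat ->
     INR (Q t) * (eps + 2 * X / INR (Q (S k))) < INR (Q (pred t)) / INR (Q 0)) ->
  forall t, (t <= k)%nat -> v t = 0%Z.
Proof.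
  intros Hm HX He Ht Hh. pose proof (Q_pos 0 ltac:(lia)) as HQ0.
  assert (T : forall t, (m < t <= k)%nat -> (N t * v 0%nat = Z.of_nat (Q 0) * v t)%Z).
  { intros t Htt. apply (tail_zero t eps X v); [lia|exact HX|apply He; lia|apply Ht; lia]. }
  pose proof (head_zero (S m) eps X v ltac:(lia) HX He Hh) as H.
  assert (V0 : v 0%nat = 0%Z).
  { specialize (T (S m) ltac:(lia)). specialize (H (S m) ltac:(lia)). rewrite T in H. lia. }
  intros t Htk. destruct (Nat.eq_dec t 0) as [->|]; [exact V0|].
  destruct (Nat.le_gt_cases t m) as [Hle|Hgt].
  - specialize (H t ltac:(lia)). pose proof (quo_pos 0 t ltac:(lia)).
    rewrite V0 in H. nia.
  - specialize (T t ltac:(lia)). rewrite V0 in T. nia.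
Qed.

(** This is [Q i] times the vector of 1 and partial sums of the [zeta t], where the term [1 / Q t]
    is included exactly for [t <= i]. These are the terms for which the chain of divisibility makes
    the product an integer. *)
Definition conv (i t : nat) : Z :=
  match t with
  | O => Z.of_nat (Q i)
  | _ => (quo 0 i * N t + if (t <=? i)%nat then quo t i else 0)%Z
  end.

Lemma conv_pos i t : (1 <= t)%nat ->
  conv i t = (quo 0 i * N t + if (t <=? i)%nat then quo t i else 0)%Z.
Proof. destruct t; [lia|reflexivity]. Qed.

(** The omitted part of [zeta t] is at most [2 / Q (k+1)] for [t <= i] and at most [2 / Q t] for
    [t > i]; both denominators have index at least [i + 1]. *)
Lemma conv_error i t : (i <= k)%nat -> (1 <= t <= k)%nat ->
  Rabs (zeta t * IZR (conv i 0) - IZR (conv i t)) <= 2 * INR (Q i) / INR (Q (S i)).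
Proof.
  intros Hi Ht. rewrite (conv_pos i t) by lia. cbn [conv].
  pose proof (Q_posR 0 ltac:(lia)) as Hr. pose proof (Q_posR i ltac:(lia)) as Hqi.
  pose proof (Q_posR t ltac:(lia)) as Hqt. rewrite <- INR_IZR_INZ, plus_IZR, mult_IZR.
  rewrite quo_R by lia. unfold Rdiv at 2. rewrite (Rmult_comm 2), Rmult_assoc.
  destruct (Nat.leb_spec t i) as [H|H].
  - rewrite quo_R by lia.
    replace (zeta t * INR (Q i) - (INR (Q i) / INR (Q 0) * IZR (N t) + INR (Q i) / INR (Q t)))
      with (INR (Q i) * (zeta t - IZR (N t) / INR (Q 0) - / INR (Q t))) by (field; lra).
    rewrite Rabs_mult, Rabs_pos_eq by lra. apply Rmult_le_compat_l; [lra|].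
    eapply Rle_trans; [apply tail1; lia|]. apply Rmult_le_compat_l; [lra|].
    apply Q_inv_le; lia.
  - replace (zeta t * INR (Q i) - (INR (Q i) / INR (Q 0) * IZR (N t) + 0))
      with (INR (Q i) * (zeta t - IZR (N t) / INR (Q 0))) by (field; lra).
    rewrite Rabs_mult, Rabs_pos_eq by lra. apply Rmult_le_compat_l; [lra|].
    eapply Rle_trans; [apply tail0; lia|]. apply Rmult_le_compat_l; [lra|].
    apply Q_inv_le; lia.
Qed.

(** Coordinate 0 eliminates the contribution of [N t] from coordinate [t = a + s]. What remains,
    multiplied by [Q t], is the suffix sum from [s] of the terms [c l * Q (a+l)]. *)
Lemma conv_indep a j : (a + j <= k + 1)%nat -> lin_indep j k (fun l => conv (a + l)).
Proof.
  intros Haj c Hc. destruct j as [|j]; [lia|].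
  pose proof (Hc 0%nat ltac:(lia)) as H0. cbn [conv] in H0.
  pose proof (Q_pos 0 ltac:(lia)) as HQ0.
  assert (H0' : zsum (S j) (fun l => (c l * quo 0 (a + l))%Z) = 0%Z).
  { apply (Z.mul_reg_l _ _ (Z.of_nat (Q 0))); [lia|]. rewrite <- zsum_scal, Z.mul_0_r.
    etransitivity; [|exact H0]. apply zsum_ext. intros l Hl.
    rewrite <- (quo_spec 0 (a + l)) by lia. ring. }
  assert (F : forall l, (l < S j)%nat -> (c l * Z.of_nat (Q (a + l)))%Z = 0%Z).
  { apply (suffix_sums_zero (S j) (fun l => (c l * Z.of_nat (Q (a + l)))%Z)).
    (* For [a + s = 0] the suffix sum is the whole sum, which is coordinate 0 itself. *)
    intros s Hs. destruct (Nat.eq_dec (a + s) 0) as [E|E].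
    - etransitivity; [|exact H0]. apply zsum_ext. intros l _.
      destruct (Nat.leb_spec s l); [reflexivity|lia].
    - specialize (Hc (a + s)%nat ltac:(lia)).
      set (t := (a + s)%nat) in *.
      assert (Hct : zsum (S j) (fun l => (N t * (c l * quo 0 (a + l))
                + 1 * (c l * (if (t <=? a + l)%nat then quo t (a + l) else 0)))%Z) = 0%Z).
      { etransitivity; [|exact Hc]. apply zsum_ext. intros l _.
        rewrite (conv_pos (a + l) t) by lia. ring. }
      rewrite zsum_lin, H0' in Hct.
      transitivity (Z.of_nat (Q t) * zsum (S j)
        (fun l => (c l * (if (t <=? a + l)%nat then quo t (a + l) else 0))%Z))%Z; [|nia].
      rewrite <- zsum_scal. apply zsum_ext. intros l Hl.
      destruct (Nat.leb_spec s l), (Nat.leb_spec t (a + l)); try (unfold t in *; lia).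
      rewrite <- (quo_spec t (a + l)) by lia. ring. }
  intros l Hl. specialize (F l Hl). pose proof (Q_pos (a + l) ltac:(lia)). nia.
Qed.

Lemma conv_approx_sol i X nu : (i <= k)%nat -> INR (Q i) <= X ->
  ln 2 + nu * ln X <= ln (INR (Q (S i))) - ln (INR (Q i)) ->
  approx_sol k zeta X nu (conv i).
Proof.
  intros Hi HX Hnu. pose proof (Q_posR i ltac:(lia)) as Hp.
  pose proof (Q_posR (S i) ltac:(lia)) as Hp'. split.
  - cbn [conv]. rewrite <- INR_IZR_INZ, Rabs_pos_eq; lra.
  - intros t Ht. eapply Rle_trans; [apply conv_error; auto|].
    replace (2 * INR (Q i) / INR (Q (S i))) with
      (exp (ln 2 + ln (INR (Q i)) + - ln (INR (Q (S i))))).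
    + apply exp_le. lra.
    + rewrite !exp_plus, exp_Ropp, !exp_ln by lra. reflexivity.
Qed.

End Scale.

(** * Eventual statements and the choice of a tolerance *)

Lemma eventually_forall_le K (P : nat -> nat -> Prop) :
  (forall i, (i <= K)%nat -> eventually (P i)) ->
  eventually (fun n => forall i, (i <= K)%nat -> P i n).
Proof.
  induction K as [|K IH]; intros H.
  - destruct (H 0%nat (le_n 0)) as [n0 Hn]. exists n0. intros n Hle i Hi.
    replace i with 0%nat by lia. auto.
  - destruct (IH (fun i Hi => H i (le_S _ _ Hi))) as [n1 H1].
    destruct (H (S K) (le_n _)) as [n2 H2].
    exists (max n1 n2). intros n Hn i Hi. destruct (Nat.eq_dec i (S K)) as [->|].
    + apply H2. lia.
    + apply H1; lia.
Qed.

Lemma ln_2_le_1 : ln 2 <= 1.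
Proof.
  rewrite <- (ln_exp 1). apply Rcomplements.ln_le; [lra|].
  pose proof (exp_ineq1_le 1). lra.
Qed.

Lemma small_positive (C a : R) : 0 <= C -> 0 < a -> exists g, 0 < g <= / 3 /\ g * C <= a.
Proof.
  intros HC Ha. exists (Rmin (/ 3) (a / (C + 1))).
  assert (Hp : 0 < a / (C + 1)) by (apply Rdiv_lt_0_compat; lra).
  pose proof (Rmin_l (/ 3) (a / (C + 1))). pose proof (Rmin_r (/ 3) (a / (C + 1))).
  split; [split; [apply Rmin_glb_lt; lra|lra]|].
  apply Rle_trans with (a / (C + 1) * (C + 1)).
  - apply Rmult_le_compat; try lra. apply Rmin_glb; lra.
  - right. field. lra.
Qed.

(** * Asymptotics along the chain of scales *)

Section Chain.

Variables (k : nat) (Q : nat -> nat -> nat) (N : nat -> nat -> Z) (zeta eta : nat -> R).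
Hypothesis k_pos : (1 <= k)%nat.
Hypothesis Q_pos : forall n i, (i <= S k)%nat -> (0 < Q n i)%nat.
Hypothesis Q_div : forall n i, (i <= k)%nat -> Nat.divide (Q n i) (Q n (S i)).
Hypothesis Q_lt : forall n i, (i <= k)%nat -> (Q n i < Q n (S i))%nat.
Hypothesis Q_glue0 : forall n, Q n k = Q (S n) 0%nat.
Hypothesis Q_glue1 : forall n, Q n (S k) = Q (S n) 1%nat.
Hypothesis tail0 : forall n t, (1 <= t <= k)%nat ->
  Rabs (zeta t - IZR (N n t) / INR (Q n 0%nat)) <= 2 / INR (Q n t).
Hypothesis tail1 : forall n t, (1 <= t <= k)%nat ->
  Rabs (zeta t - IZR (N n t) / INR (Q n 0%nat) - / INR (Q n t)) <= 2 / INR (Q n (S k)).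

Definition lg (n i : nat) : R := ln (INR (Q n i)).

Hypothesis lim_eta : forall i, (1 <= i <= k)%nat ->
  is_lim_seq (fun n => (lg n i - lg n (pred i)) / lg n k) (eta i).
Hypothesis lim_infty : is_lim_seq (fun n => lg n (S k) / lg n k) p_infty.
Hypothesis eta_sum : psum eta k = 1.
Hypothesis eta_1_pos : 0 < eta 1%nat.
Hypothesis eta_mono : forall i, (1 <= i < k)%nat -> eta i <= eta (S i).

Lemma eta_le i j : (1 <= i <= j)%nat -> (j <= k)%nat -> eta i <= eta j.
Proof.
  intros Hi. induction j as [|j IH]; intros Hj; [lia|].
  destruct (Nat.eq_dec i (S j)) as [->|]; [lra|].
  apply Rle_trans with (eta j); [apply IH; lia|apply eta_mono; lia].
Qed.

Lemma psum_ge_eta i j : (1 <= i <= j)%nat -> (j <= k)%nat -> eta i <= psum eta j.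
Proof.
  assert (P : forall m, (m <= k)%nat -> 0 <= psum eta m).
  { induction m as [|m IH]; intros Hm; simpl; [lra|].
    pose proof (IH ltac:(lia)). pose proof (eta_le 1 (S m) ltac:(lia) ltac:(lia)). lra. }
  intros Hi. induction j as [|j IH]; intros Hj; [lia|]. simpl.
  pose proof (P j ltac:(lia)). pose proof (eta_le 1 (S j) ltac:(lia) ltac:(lia)).
  destruct (Nat.eq_dec i (S j)) as [->|]; [lra|].
  pose proof (IH ltac:(lia) ltac:(lia)). lra.
Qed.

Lemma eta_le_1 i : (1 <= i <= k)%nat -> eta i <= 1.
Proof. intros H. rewrite <- eta_sum. apply psum_ge_eta; lia. Qed.

Lemma QR_pos n i : (i <= S k)%nat -> 0 < INR (Q n i).
Proof. intros H. apply lt_0_INR, Q_pos, H. Qed.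

Lemma exp_lg n i : (i <= S k)%nat -> exp (lg n i) = INR (Q n i).
Proof. intros H. apply exp_ln, QR_pos, H. Qed.

Lemma lg_le n i j : (i <= j <= S k)%nat -> lg n i <= lg n j.
Proof.
  intros H. apply Rcomplements.ln_le; [apply QR_pos; lia|].
  apply le_INR, (Q_le k (Q n)); auto.
Qed.

Lemma Q_growth n : (n < Q n 0)%nat.
Proof.
  induction n as [|n IH]; [apply Q_pos; lia|].
  rewrite <- Q_glue0. pose proof (Q_lt n 0 ltac:(lia)).
  pose proof (Q_le k (Q n) (Q_pos n) (Q_div n) 1 k ltac:(lia)). lia.
Qed.

Lemma lg_unbounded B : eventually (fun n => B <= lg n 0).
Proof.
  destruct (INR_unbounded (exp B)) as [n0 Hn]. exists n0. intros n Hle.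
  rewrite <- (ln_exp B). apply Rcomplements.ln_le; [apply exp_pos|].
  apply Rlt_le, (Rlt_trans _ _ _ Hn), lt_INR. pose proof (Q_growth n). lia.
Qed.

Lemma lg_k_unbounded B : eventually (fun n => B <= lg n k).
Proof.
  destruct (lg_unbounded B) as [n0 H]. exists n0. intros n Hn.
  eapply Rle_trans; [apply (H n Hn)|apply lg_le; lia].
Qed.

Lemma lg_next_large M : eventually (fun n => M * lg n k <= lg n (S k)).
Proof.
  destruct (proj2 (is_lim_seq_spec _ _) lim_infty M) as [n1 H1]. destruct (lg_k_unbounded 1) as [n2 H2].
  exists (max n1 n2). intros n Hn. specialize (H1 n ltac:(lia)). specialize (H2 n ltac:(lia)).
  apply (Rmult_lt_compat_r (lg n k)) in H1; [|lra].
  replace (lg n (S k) / lg n k * lg n k) with (lg n (S k)) in H1 by (field; lra). lra.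
Qed.

(** Scale [n] agrees with its limit shape up to errors [g * lg n k]; [regular_large] lets constants
    such as [ln 2] be absorbed into that error. *)
Record regular (g : R) (n : nat) : Prop := {
  regular_large : 1 <= g * lg n k;
  regular_lg : forall i, (i <= k)%nat -> Rabs (lg n i - psum eta i * lg n k) <= g * lg n k;
  regular_step : forall i, (i < k)%nat ->
    Rabs (lg n (S i) - lg n i - eta (S i) * lg n k) <= g * lg n k;
  regular_next : 4 * lg n k <= lg n (S k);
  regular_base : ln 2 <= lg n 0 }.

Lemma steps_eventually g : 0 < g -> eventually (fun n => forall i, (i <= pred k)%nat ->
  Rabs (lg n (S i) - lg n i - eta (S i) * lg n k) <= g * lg n k).
Proof.
  intros Hg. apply eventually_forall_le. intros i Hi.
  pose proof (lim_eta (S i) ltac:(lia)) as Hl. apply is_lim_seq_spec in Hl.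
  destruct (Hl (mkposreal g Hg)) as [n1 H1]. simpl in H1.
  destruct (lg_k_unbounded 1) as [n2 H2].
  exists (max n1 n2). intros n Hn. specialize (H1 n ltac:(lia)). specialize (H2 n ltac:(lia)).
  replace (lg n (S i) - lg n i - eta (S i) * lg n k)
    with (((lg n (S i) - lg n i) / lg n k - eta (S i)) * lg n k) by (field; lra).
  rewrite Rabs_mult, (Rabs_pos_eq (lg n k)) by lra.
  apply Rmult_le_compat_r; lra.
Qed.

(** The steps telescope to [lg n i - lg n 0]. At [i = k], where the [eta] sum to 1, the estimate
    says that [lg n 0] itself is negligible. *)
Lemma regular_eventually g : 0 < g -> eventually (regular g).
Proof.
  intros Hg. assert (Hk : 1 <= INR k) by (apply (le_INR 1); lia).
  (* At most [k] step errors come from telescoping, and as many again from the bound on [lg n 0]. *)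
  assert (Hg' : 0 < g / (2 * INR k)) by (apply Rdiv_lt_0_compat; lra).
  destruct (steps_eventually _ Hg') as [n1 H1].
  destruct (lg_next_large 4) as [n2 H2]. destruct (lg_unbounded 1) as [n3 H3].
  destruct (lg_k_unbounded (/ g)) as [n4 H4].
  exists (max (max n1 n2) (max n3 n4)). intros n Hn.
  specialize (H1 n ltac:(lia)). specialize (H2 n ltac:(lia)).
  specialize (H3 n ltac:(lia)). specialize (H4 n ltac:(lia)).
  pose proof (lg_le n 0 k ltac:(lia)) as H0.
  set (d := g / (2 * INR k) * lg n k) in *.
  assert (Hd : 2 * INR k * d = g * lg n k) by (unfold d; field; lra).
  assert (Hd0 : 0 <= d) by (apply Rmult_le_pos; lra).
  assert (S0 : forall i, (i <= k)%nat ->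
    Rabs (lg n i - lg n 0 - psum eta i * lg n k) <= INR i * d).
  { induction i as [|i IH]; intros Hi.
    - simpl. rewrite Rabs_pos_eq; lra.
    - specialize (IH ltac:(lia)). specialize (H1 i ltac:(lia)). rewrite S_INR. simpl psum.
      apply Rabs_le_between in IH. apply Rabs_le_between in H1. apply Rabs_le. lra. }
  assert (Hk0 : lg n 0 <= INR k * d).
  { pose proof (S0 k ltac:(lia)) as Hs. rewrite eta_sum in Hs.
    apply Rabs_le_between in Hs. lra. }
  split.
  - apply (Rmult_le_compat_l g) in H4; [|lra]. rewrite Rinv_r in H4; lra.
  - intros i Hi. specialize (S0 i Hi). apply Rabs_le_between in S0.
    assert (INR i * d <= INR k * d) by (apply Rmult_le_compat_r; [lra|apply le_INR; lia]).
    apply Rabs_le. lra.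
  - intros i Hi. eapply Rle_trans; [apply H1; lia|]. nra.
  - exact H2.
  - pose proof ln_2_le_1. lra.
Qed.

(** * Thresholds and upper bounds *)

(* Logarithms of the heights separating the ranges of [X]: up to [thr n (m+1)] an approximation
   cannot see [1/Q n (m+1)]. The cubes absorb the denominators of the partial sums. *)
Definition thr (n m : nat) : R :=
  if (m <=? k)%nat then lg n m - 3 * lg n 0 else lg n m - 3 * lg n k.

(** The ranges of consecutive scales leave no gap, since [Q n k] is the base of scale [n + 1]. *)
Lemma thr_glue n : thr n (S k) = thr (S n) 1.
Proof.
  unfold thr. destruct (Nat.leb_spec (S k) k); [lia|].
  destruct (Nat.leb_spec 1 k); [|lia]. unfold lg. rewrite Q_glue0, Q_glue1. reflexivity.
Qed.

Lemma thr_ge g n m : regular g n -> (m <= k)%nat -> (psum eta m - 4 * g) * lg n k <= thr n m.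
Proof.
  intros H Hm. unfold thr. destruct (Nat.leb_spec m k) as [_|]; [|lia].
  pose proof (regular_lg g n H m Hm) as Hl. pose proof (regular_lg g n H 0 ltac:(lia)) as H0.
  simpl psum in H0. apply Rabs_le_between in Hl. apply Rabs_le_between in H0. lra.
Qed.

(** The value 0 belongs to [p = 0], where no coordinate is tied to the next partial sum. The
    truncated subtraction [m + 2 - j] reaches it. *)
Definition eta0 (i : nat) : R := match i with O => 0 | _ => eta i end.

(** Logarithmic form of the two conditions of [dependent_of_small]. The height controls the first;
    the second rests on [eta t <= eta p], the ratio of [Q n t] to [Q n (t-1)] being about
    [exp (eta t * L)]. *)
Lemma smallness g n m p X eps :
  regular g n -> 0 < g <= / 3 -> (m <= k)%nat -> (p <= k)%nat ->
  0 < X -> ln X <= thr n (S m) -> eps < exp (- ((eta0 p + 3 * g) * lg n k)) ->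
  (forall t, (m < t <= k)%nat -> INR (Q n 0) * (eps + 2 * X / INR (Q n t)) < 1) /\
  (forall t, (1 <= t <= p)%nat ->
     INR (Q n t) * (eps + 2 * X / INR (Q n (S k))) < INR (Q n (pred t)) / INR (Q n 0)).
Proof.
  intros Hreg Hg Hm Hp HX Hthr Heps. pose proof ln_2_le_1 as Hln2.
  destruct Hreg as [Hlarge Hlg Hstep Hnext Hbase].
  pose proof (Hlg 0%nat ltac:(lia)) as H0. simpl psum in H0. apply Rabs_le_between in H0.
  set (L := lg n k) in *.
  assert (HL : 3 <= L) by nra.
  assert (Heta : 0 <= eta0 p <= 1).
  { destruct p as [|p]; simpl; [lra|]. split; [|apply eta_le_1; lia].
    pose proof (eta_le 1 (S p) ltac:(lia) ltac:(lia)). lra. }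
  assert (HQX : forall t, (t <= S k)%nat -> 2 * X / INR (Q n t) = exp (ln 2 + ln X - lg n t)).
  { intros t Ht. unfold Rminus. rewrite !exp_plus, exp_Ropp, exp_lg, !exp_ln by lra || lia.
    reflexivity. }
  assert (HE : 0 <= eta0 p * L <= L) by nra.
  split.
  - intros t Ht. rewrite HQX by lia.
    assert (Ht' : ln X <= lg n t - 3 * lg n 0).
    { unfold thr in Hthr. destruct (Nat.leb_spec (S m) k); [|lia].
      pose proof (lg_le n (S m) t ltac:(lia)). lra. }
    rewrite <- exp_lg by lia. rewrite Rmult_plus_distr_l, <- exp_plus.
    assert (E2 : exp (- ln 2) = / 2) by (rewrite exp_Ropp, exp_ln; lra).
    (* Each summand gets half of 1: this one because [lg n 0] uses only one of the three [g * L],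
       the next by the cube in [thr] and [ln 2 <= lg n 0]. *)
    assert (A1 : exp (lg n 0) * eps < / 2).
    { eapply Rlt_le_trans; [apply Rmult_lt_compat_l; [apply exp_pos|exact Heps]|].
      rewrite <- exp_plus, <- E2. apply exp_le. lra. }
    assert (A2 : exp (lg n 0 + (ln 2 + ln X - lg n t)) <= / 2).
    { rewrite <- E2. apply exp_le. lra. }
    lra.
  - intros t Ht. rewrite HQX by lia.
    assert (HXk : ln X <= lg n (S k) - 3 * L).
    { unfold thr in Hthr. destruct (Nat.leb_spec (S m) k).
      - pose proof (lg_le n (S m) k ltac:(lia)). fold L in H1.
        pose proof ln_lt_2. lra.
      - replace m with k in Hthr by lia. exact Hthr. }
    (* Here [(eta0 p + 3 * g) * L] is at most [2 * L], and the remaining [L] of the [3 * L] absorbs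
       [ln 2]. *)
    assert (A : exp (ln 2 + ln X - lg n (S k)) <= exp (- ((eta0 p + 3 * g) * L))).
    { apply exp_le. nra. }
    apply Rlt_le_trans with (INR (Q n t) * (2 * exp (- ((eta0 p + 3 * g) * L)))).
    { apply Rmult_lt_compat_l; [apply QR_pos; lia|lra]. }
    replace (INR (Q n (pred t)) / INR (Q n 0)) with (exp (lg n (pred t) - lg n 0)).
    2:{ unfold Rminus. rewrite exp_plus, exp_Ropp, !exp_lg by lia. reflexivity. }
    replace (INR (Q n t) * (2 * exp (- ((eta0 p + 3 * g) * L))))
      with (exp (lg n t + (ln 2 + - ((eta0 p + 3 * g) * L)))).
    2:{ rewrite !exp_plus, exp_lg, exp_ln by lra || lia. reflexivity. }
    (* The three [g] pay for the error of the step, the factor 2 and the division by [Q n 0]. *)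
    apply exp_le. destruct t as [|t]; [lia|]. simpl pred.
    specialize (Hstep t ltac:(lia)). apply Rabs_le_between in Hstep.
    assert (Hmon : eta (S t) <= eta0 p).
    { destruct p as [|p]; [lia|]. apply eta_le; lia. }
    apply (Rmult_le_compat_r L) in Hmon; lra.
Qed.

(** The choice [p = m + 2 - j] is the least with [m + 1 < j + p], and [2 <= j] keeps it at most [m].
    If [m + 2 < j], truncation to 0 is still correct. *)
Lemma not_admissible g n m j X nu :
  regular g n -> 0 < g <= / 3 -> (m <= k)%nat -> (2 <= j)%nat ->
  0 < X -> ln X <= thr n (S m) ->
  (eta0 (m + 2 - j) + 3 * g) * lg n k < nu * ln X ->
  ~ admissible k zeta j X nu.
Proof.
  intros Hreg Hg Hm Hj HX Hthr Hnu [S [Hind Happ]].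
  destruct (smallness g n m (m + 2 - j) X (Rpower X (- nu))) as [Ht Hh]; auto; [lia| |].
  - apply exp_increasing. lra.
  - revert Hind.
    apply (dependent_of_small k (Q n) (N n) zeta (Q_pos n) (Q_div n) (tail0 n) (tail1 n)
      j m (m + 2 - j) (Rpower X (- nu)) X); auto; lia.
Qed.

(** For a single vector [p = m + 1] exceeds [m], so the dimension count gives way to
    [zero_of_small]: the vector itself vanishes. *)
Lemma not_admissible_1 g n m X nu :
  regular g n -> 0 < g <= / 3 -> (m < k)%nat ->
  0 < X -> ln X <= thr n (S m) ->
  (eta (S m) + 3 * g) * lg n k < nu * ln X ->
  ~ admissible k zeta 1 X nu.
Proof.
  intros Hreg Hg Hm HX Hthr Hnu [S [Hind Happ]].
  destruct (smallness g n m (Datatypes.S m) X (Rpower X (- nu))) as [Ht Hh]; auto; [lia| |].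
  - apply exp_increasing. simpl eta0. lra.
  - destruct (Happ 0%nat ltac:(lia)) as [HX0 He].
    pose proof (zero_of_small k (Q n) (N n) zeta (Q_pos n) (Q_div n) (tail0 n) (tail1 n)
      m (Rpower X (- nu)) X (S 0%nat) Hm HX0 He Ht Hh) as Hz.
    specialize (Hind (fun _ => 1%Z)). specialize (Hind ltac:(
      intros t Htk; cbn -[Z.mul]; rewrite Hz by lia; reflexivity) 0%nat ltac:(lia)).
    discriminate.
Qed.

(** The loss [g * (3 + 4 * (M + e))] collects the [3 * g] of [smallness] and the [4 * g] of
    [thr_ge]. The margin [e * psum eta m], at least [e * eta 1], covers it. *)
Lemma exponent_upper g n m M e nu x a :
  regular g n -> 0 < g -> 0 <= M -> 0 < e -> (1 <= m <= k)%nat ->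
  g * (3 + 4 * (M + e)) <= e * eta 1%nat -> a <= M * psum eta m ->
  M + e < nu -> thr n m <= x -> (a + 3 * g) * lg n k < nu * x.
Proof.
  intros Hreg Hg HM He Hm Hgs Ha Hnu Hx.
  pose proof (thr_ge g n m Hreg ltac:(lia)) as Hthr.
  pose proof (regular_large g n Hreg) as Hl.
  pose proof (psum_ge_eta 1 m ltac:(lia) ltac:(lia)) as Hs.
  assert (HL : 0 < lg n k) by nra.
  assert (H1 : a + 3 * g <= (M + e) * (psum eta m - 4 * g)) by nra.
  assert (Hp : 0 < psum eta m - 4 * g) by nra.
  assert (Hx0 : 0 < x) by (pose proof (Rmult_lt_0_compat _ _ Hp HL); lra).
  apply Rle_lt_trans with ((M + e) * x); [|apply Rmult_lt_compat_r; lra].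
  apply Rle_trans with ((M + e) * ((psum eta m - 4 * g) * lg n k)).
  - rewrite <- Rmult_assoc. apply Rmult_le_compat_r; lra.
  - apply Rmult_le_compat_l; lra.
Qed.

Lemma thr_unbounded g m B : 0 < g -> 8 * g <= eta 1%nat -> (1 <= m <= k)%nat ->
  eventually (fun n => regular g n /\ B <= thr n m).
Proof.
  intros Hg Hs Hm. destruct (regular_eventually g Hg) as [n1 H1].
  destruct (lg_k_unbounded (Rmax 0 B / (4 * g))) as [n2 H2].
  exists (max n1 n2). intros n Hn. specialize (H1 n ltac:(lia)). specialize (H2 n ltac:(lia)).
  split; [exact H1|]. eapply Rle_trans; [|apply (thr_ge g); [exact H1|lia]].
  pose proof (psum_ge_eta 1 m ltac:(lia) ltac:(lia)).
  pose proof (Rmax_l 0 B). pose proof (Rmax_r 0 B).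
  apply (Rmult_le_compat_l (4 * g)) in H2; [|lra].
  replace (4 * g * (Rmax 0 B / (4 * g))) with (Rmax 0 B) in H2 by (field; lra).
  nra.
Qed.

Lemma gamma_exists M e : 0 <= M -> 0 < e -> exists g,
  0 < g <= / 3 /\ 8 * g <= eta 1%nat /\ g * (3 + 4 * (M + e)) <= e * eta 1%nat.
Proof.
  intros HM He.
  destruct (small_positive 8 (eta 1%nat) ltac:(lra) eta_1_pos) as [g1 [H1 H1']].
  destruct (small_positive (3 + 4 * (M + e)) (e * eta 1%nat)) as [g2 [H2 H2']]; [lra|nra|].
  exists (Rmin g1 g2). pose proof (Rmin_l g1 g2). pose proof (Rmin_r g1 g2).
  assert (0 < Rmin g1 g2) by (apply Rmin_glb_lt; lra).
  repeat split; try lra. nra.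
Qed.

(** Every large [ln X] lies first in one scale and then between [thr n m] and [thr n (m+1)] with
    [1 <= m <= k]. The upper end bounds the rank of the solutions, the lower end converts the error
    into an exponent. *)
Lemma omega_upper j M : (2 <= j)%nat -> 0 <= M ->
  (forall m, (1 <= m <= k)%nat -> eta0 (m + 2 - j) <= M * psum eta m) ->
  Rbar_le (omega k zeta j) M.
Proof.
  intros Hj HM HF. apply Rbar_le_of_eps. intros e He.
  destruct (gamma_exists M e HM He) as [g [Hg [Hg8 Hgs]]].
  apply omega_le. destruct (regular_eventually g (proj1 Hg)) as [n0 Hn0].
  exists (exp (thr n0 1)). intros X HX.
  assert (HX0 : 0 < X) by (eapply Rlt_le_trans; [apply exp_pos|exact HX]).
  apply omega_X_le. intros nu Hnu.
  assert (Hx : thr n0 1 <= ln X).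
  { rewrite <- (ln_exp (thr n0 1)). apply Rcomplements.ln_le; [apply exp_pos|exact HX]. }
  destruct (crossing_unbounded (fun n => thr n 1) n0 (ln X)) as [n [Hn Hnx]]; [exact Hx| |].
  { destruct (thr_unbounded g 1 (ln X + 1) (proj1 Hg) Hg8 ltac:(lia)) as [n1 H1].
    exists (max n0 n1). split; [lia|]. destruct (H1 (max n0 n1) ltac:(lia)). lra. }
  rewrite <- thr_glue in Hnx.
  destruct (crossing (thr n) 1 k (ln X)) as [m [Hm Hmx]]; [exact Hnx|].
  apply (not_admissible g n m); auto; try lia; try lra.
  apply (exponent_upper g n m M e); auto; try lia; try lra.
  apply HF. lia.
Qed.

(** The test height is [exp (thr n m)], the top of the range of index [m - 1]. *)
Lemma omega_hat_1_upper m : (1 <= m <= k)%nat ->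
  Rbar_le (omega_hat k zeta 1) (eta m / psum eta m).
Proof.
  intros Hm. apply Rbar_le_of_eps. intros e He.
  pose proof (psum_ge_eta 1 m ltac:(lia) ltac:(lia)) as Hs.
  pose proof (eta_le 1 m ltac:(lia) ltac:(lia)) as Hem.
  assert (HM : 0 <= eta m / psum eta m) by (apply Rlt_le, Rdiv_lt_0_compat; lra).
  destruct (gamma_exists _ e HM He) as [g [Hg [Hg8 Hgs]]].
  apply omega_hat_le. intros T.
  destruct (thr_unbounded g m T (proj1 Hg) Hg8 Hm) as [n H].
  destruct (H n (le_n n)) as [Hreg HT]. exists (exp (thr n m)). split.
  { pose proof (exp_ineq1_le (thr n m)). lra. }
  apply omega_X_le. intros nu Hnu. destruct m as [|m]; [lia|].
  apply (not_admissible_1 g n m); auto; try lia; [apply exp_pos|rewrite ln_exp; lra|].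
  rewrite ln_exp. apply (exponent_upper g n (S m) (eta (S m) / psum eta (S m)) e); auto; try lra.
  right. field. lra.
Qed.

(** At the height [exp (thr n 1)] every coordinate is tied to coordinate 0, so two vectors with
    small errors are already dependent. *)
Lemma omega_hat_upper j : (2 <= j)%nat -> Rbar_le (omega_hat k zeta j) 0.
Proof.
  intros Hj. apply Rbar_le_of_eps. intros e He.
  destruct (gamma_exists 0 e (Rle_refl 0) He) as [g [Hg [Hg8 Hgs]]].
  apply omega_hat_le. intros T.
  destruct (thr_unbounded g 1 T (proj1 Hg) Hg8 ltac:(lia)) as [n H].
  destruct (H n (le_n n)) as [Hreg HT]. exists (exp (thr n 1)). split.
  { pose proof (exp_ineq1_le (thr n 1)). lra. }
  apply omega_X_le. intros nu Hnu.
  apply (not_admissible g n 0); auto; try lia; [apply exp_pos|rewrite ln_exp; lra|].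
  rewrite ln_exp. apply (exponent_upper g n 1 0 e); auto; try lra; try lia.
  replace (0 + 2 - j)%nat with 0%nat by lia. simpl. lra.
Qed.

(** * Lower bounds *)

Lemma omega_hat_lower j : (j <= k + 1)%nat -> Rbar_le 0 (omega_hat k zeta j).
Proof.
  intros Hj. apply omega_hat_ge. exists 1. intros X HX.
  apply omega_X_ge, admissible_zero; auto.
Qed.

Lemma admissible_conv n a j X nu : (a + j <= k + 1)%nat ->
  (forall i, (a <= i < a + j)%nat -> INR (Q n i) <= X /\
     ln 2 + nu * ln X <= lg n (S i) - lg n i) ->
  admissible k zeta j X nu.
Proof.
  intros Haj H. exists (fun l => conv (Q n) (N n) (a + l)). split.
  - apply (conv_indep k); auto.
  - intros l Hl. destruct (H (a + l)%nat ltac:(lia)) as [H1 H2].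
    apply conv_approx_sol; auto. lia.
Qed.

Lemma omega_1_infinite : omega k zeta 1 = p_infty.
Proof.
  apply Rbar_p_infty_of_ge. intros a. apply omega_ge. intros T.
  (* One of the two extra units covers [lg n k] in the error of [conv k], the other covers
     [ln 2]. *)
  destruct (lg_next_large (a + 2)) as [n1 H1].
  destruct (lg_k_unbounded (Rmax 1 T)) as [n2 H2].
  set (n := max n1 n2). specialize (H1 n ltac:(lia)). specialize (H2 n ltac:(lia)).
  pose proof (Rmax_l 1 T). pose proof (Rmax_r 1 T).
  exists (INR (Q n k)). split.
  - rewrite <- exp_lg by lia. pose proof (exp_ineq1_le (lg n k)). lra.
  - apply omega_X_ge, (admissible_conv n k); [lia|]. intros i Hi.
    replace i with k by lia. split; [lra|]. fold (lg n k).
    pose proof ln_2_le_1. lra.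
Qed.

(** At the height [Q n m], use the [j] vectors of indices [m + 1 - j, ..., m]. Their errors have
    exponents governed by [eta (i+1)], of which the smallest is [eta (m + 2 - j)] by
    monotonicity. *)
Lemma omega_lower j m : (2 <= j)%nat -> (j - 1 <= m <= k)%nat ->
  Rbar_le (eta (m + 2 - j)%nat / psum eta m) (omega k zeta j).
Proof.
  intros Hj Hm. apply Rbar_ge_of_eps. intros e He.
  pose proof (psum_ge_eta 1 m ltac:(lia) ltac:(lia)) as Hs.
  pose proof (eta_le 1 (m + 2 - j) ltac:(lia) ltac:(lia)) as Hep.
  set (p := (m + 2 - j)%nat) in *. set (F := eta p / psum eta m).
  assert (HFe : F * psum eta m = eta p) by (unfold F; field; lra).
  assert (HF : 0 < F) by (apply Rdiv_lt_0_compat; lra).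
  destruct (small_positive (F + e + 2) (e * eta 1%nat)) as [g [Hg Hgs]]; [lra|nra|].
  apply omega_ge. intros T.
  destruct (regular_eventually g (proj1 Hg)) as [n1 H1].
  destruct (lg_unbounded T) as [n2 H2].
  set (n := max n1 n2). specialize (H1 n ltac:(lia)). specialize (H2 n ltac:(lia)).
  destruct H1 as [Hlarge Hlg Hstep Hnext Hbase].
  exists (INR (Q n m)). split.
  - rewrite <- exp_lg by lia. pose proof (exp_ineq1_le (lg n m)).
    pose proof (lg_le n 0 m ltac:(lia)). lra.
  - apply omega_X_ge, (admissible_conv n (m + 1 - j)); [lia|]. intros i Hi. split.
    + apply le_INR, (Q_le k (Q n)); auto. lia.
    + fold (lg n m). pose proof ln_2_le_1.
      specialize (Hlg m ltac:(lia)). apply Rabs_le_between in Hlg.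
      set (L := lg n k) in *. assert (HL : 0 < L) by nra.
      (* The [2 * g] are reserved for [ln 2] and the error of the step. Since [F - e] may be
         negative, its two terms are bounded separately. *)
      assert (G : (F - e) * lg n m <= (eta p - 2 * g) * L).
      { assert (F * lg n m <= F * ((psum eta m + g) * L)) by (apply Rmult_le_compat_l; lra).
        assert (e * ((psum eta m - g) * L) <= e * lg n m) by (apply Rmult_le_compat_l; lra).
        assert (F * (psum eta m + g) - e * (psum eta m - g) <= eta p - 2 * g) by nra.
        apply (Rmult_le_compat_r L) in H3; lra. }
      assert (K : (eta p - g) * L <= lg n (S i) - lg n i).
      { destruct (Nat.eq_dec i k) as [->|Hik].
        - fold L. pose proof (eta_le_1 p ltac:(lia)). nra.
        - specialize (Hstep i ltac:(lia)). apply Rabs_le_between in Hstep.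
          pose proof (eta_le p (S i) ltac:(lia) ltac:(lia)) as Hm'.
          apply (Rmult_le_compat_r L) in Hm'; lra. }
      lra.
Qed.

(** Any large [X] lies between some [Q n m] and [Q n (m+1)] with [m < k]. There [conv m] has an
    error of exponent about [eta (m+1)] on the scale [L], while [ln X] is at most about
    [psum eta (m+1) * L]. *)
Lemma omega_hat_1_lower G :
  (forall m, (1 <= m <= k)%nat -> G * psum eta m <= eta m) ->
  Rbar_le G (omega_hat k zeta 1).
Proof.
  intros HG. apply Rbar_ge_of_eps. intros e He.
  (* The bound 0 settles this case; afterwards [G - e] is positive and may multiply an upper bound
     for [ln X]. *)
  destruct (Rle_lt_dec (G - e) 0) as [Hneg|Hpos].
  { eapply Rbar_le_trans; [|apply (omega_hat_lower 1); lia]. exact Hneg. }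
  destruct (small_positive (G + 2) (e * eta 1%nat)) as [g [Hg Hgs]]; [lra|nra|].
  destruct (regular_eventually g (proj1 Hg)) as [n0 H0].
  apply omega_hat_ge. exists (INR (Q n0 0)). intros X HX.
  pose proof (QR_pos n0 0 ltac:(lia)) as Hq0.
  assert (Hx : lg n0 0 <= ln X) by (apply Rcomplements.ln_le; lra).
  destruct (crossing_unbounded (fun n => lg n 0) n0 (ln X)) as [n [Hn Hnx]]; [exact Hx| |].
  { destruct (lg_unbounded (ln X + 1)) as [n1 H1].
    exists (max n0 n1). split; [lia|]. specialize (H1 (max n0 n1) ltac:(lia)). lra. }
  replace (lg (S n) 0) with (lg n k) in Hnx by (unfold lg; rewrite Q_glue0; reflexivity).
  destruct (crossing (lg n) 0 k (ln X)) as [m [Hm Hmx]]; [exact Hnx|].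
  apply omega_X_ge, (admissible_conv n m); [lia|]. intros i Hi.
  replace i with m by lia. clear i Hi. split.
  - rewrite <- exp_lg by lia. rewrite <- (exp_ln X) by lra. apply exp_le. lra.
  - destruct (H0 n Hn) as [Hlarge Hlg Hstep Hnext Hbase]. pose proof ln_2_le_1.
    specialize (Hlg (S m) ltac:(lia)). apply Rabs_le_between in Hlg.
    specialize (Hstep m ltac:(lia)). apply Rabs_le_between in Hstep.
    specialize (HG (S m) ltac:(lia)).
    pose proof (psum_ge_eta 1 (S m) ltac:(lia) ltac:(lia)) as Hs.
    set (L := lg n k) in *. assert (HL : 0 < L) by nra.
    assert (A : (G - e) * ln X <= (G - e) * ((psum eta (S m) + g) * L))
      by (apply Rmult_le_compat_l; lra).
    assert (B : (G - e) * (psum eta (S m) + g) <= eta (S m) - 2 * g) by nra.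
    apply (Rmult_le_compat_r L) in B; lra.
Qed.

(** * Matching the bounds for all constants *)

Lemma chain_constants :
  omega k zeta 1%nat = p_infty /\
  (forall j, (2 <= j <= k + 1)%nat ->
     omega k zeta j =
       Finite (max_range (fun m => eta (m + 2 - j)%nat / psum eta m) (j - 1) k)) /\
  omega_hat k zeta 1%nat = Finite (min_range (fun m => eta m / psum eta m) 1 k) /\
  (forall j, (2 <= j <= k + 1)%nat -> omega_hat k zeta j = Finite 0).
Proof.
  assert (Hs : forall m, (1 <= m <= k)%nat -> 0 < psum eta m).
  { intros m Hm. pose proof (psum_ge_eta 1 m ltac:(lia) ltac:(lia)). lra. }
  split; [exact omega_1_infinite|split; [|split]].
  - intros j Hj. set (F := fun m => eta (m + 2 - j)%nat / psum eta m).
    apply Rbar_le_antisym.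
    + assert (HF : forall m, (j - 1 <= m <= k)%nat -> 0 < F m).
      { intros m Hm. apply Rdiv_lt_0_compat; [|apply Hs; lia].
        pose proof (eta_le 1 (m + 2 - j) ltac:(lia) ltac:(lia)). lra. }
      assert (HM : 0 <= max_range F (j - 1) k).
      { pose proof (HF k ltac:(lia)). pose proof (max_range_ge F (j - 1) k k ltac:(lia)). lra. }
      apply omega_upper; [lia|exact HM|].
      intros m Hm. specialize (Hs m Hm). destruct (Nat.lt_ge_cases m (j - 1)) as [Hlt|Hge].
      (* The ranges with [m < j - 1] lie outside the maximum and contribute exponent 0. *)
      * replace (m + 2 - j)%nat with 0%nat by lia. simpl. apply Rmult_le_pos; lra.
      * pose proof (max_range_ge F (j - 1) k m ltac:(lia)) as HFm.
        replace (eta0 (m + 2 - j)) with (F m * psum eta m).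
        -- apply Rmult_le_compat_r; lra.
        -- unfold F. destruct (m + 2 - j)%nat eqn:E; [lia|]. simpl. field. lra.
    + destruct (max_range_attained F (j - 1) k ltac:(lia)) as [m [Hm ->]].
      apply omega_lower; lia.
  - apply Rbar_le_antisym.
    + destruct (min_range_attained (fun m => eta m / psum eta m) 1 k k_pos) as [m [Hm ->]].
      apply omega_hat_1_upper, Hm.
    + apply omega_hat_1_lower. intros m Hm. specialize (Hs m Hm).
      pose proof (min_range_le (fun m => eta m / psum eta m) 1 k m Hm) as HG. simpl in HG.
      apply (Rmult_le_compat_r (psum eta m)) in HG; [|lra].
      replace (eta m / psum eta m * psum eta m) with (eta m) in HG by (field; lra). exact HG.
  - intros j Hj. apply Rbar_le_antisym; [apply omega_hat_upper|apply omega_hat_lower]; lia.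
Qed.

End Chain.

(** * Series of reciprocals with at least doubling denominators *)

Section DoublingSeries.

Variable u : nat -> nat.
Hypothesis u_pos : forall n, (0 < u n)%nat.
Hypothesis u_double : forall n, (2 * u n <= u (S n))%nat.

Lemma doubling_term n m : 0 <= / INR (u (n + m)%nat) <= / INR (u n) * (/ 2) ^ m.
Proof.
  assert (P : forall i, 0 < INR (u i)) by (intros i; apply lt_0_INR, u_pos).
  split; [apply Rlt_le, Rinv_0_lt_compat, P|].
  induction m as [|m IH]; [rewrite Nat.add_0_r; simpl; lra|].
  pose proof (le_INR _ _ (u_double (n + m))) as H. rewrite mult_INR in H. simpl INR in H.
  rewrite Nat.add_succ_r. pose proof (P (n + m)%nat).
  apply Rle_trans with (/ (2 * INR (u (n + m)%nat))).
  - apply Rinv_le_contravar; lra.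
  - rewrite Rinv_mult. simpl. lra.
Qed.

Lemma is_series_half (c : R) : is_series (fun m => c * (/ 2) ^ m) (2 * c).
Proof.
  assert (H : Rabs (/ 2) < 1) by (rewrite Rabs_pos_eq; lra).
  pose proof (is_series_scal_l c _ _ (is_series_geom _ H)) as G.
  replace (2 * c) with (c * / (1 - / 2)) by field. exact G.
Qed.

Lemma doubling_ex_series n : ex_series (fun m => / INR (u (n + m)%nat)).
Proof.
  apply (ex_series_le (fun m => / INR (u (n + m)%nat)) (fun m => / INR (u n) * (/ 2) ^ m)).
  - intros m. pose proof (doubling_term n m). change (norm (/ INR (u (n + m)%nat)))
      with (Rabs (/ INR (u (n + m)%nat))). rewrite Rabs_pos_eq; lra.
  - exists (2 * / INR (u n)). apply is_series_half.
Qed.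

Lemma doubling_tail n : 0 <= Series (fun m => / INR (u (n + m)%nat)) <= 2 / INR (u n).
Proof.
  assert (Z : Series (fun _ => 0) = 0).
  { apply is_series_unique. pose proof (is_series_half 0) as G. rewrite Rmult_0_r in G.
    eapply is_series_ext; [|exact G]. intros m. simpl. ring. }
  split.
  - rewrite <- Z at 1. apply Series_le; [|apply doubling_ex_series].
    intros m. pose proof (doubling_term n m). lra.
  - replace (2 / INR (u n)) with (Series (fun m => / INR (u n) * (/ 2) ^ m)).
    + apply Series_le; [intros m; apply doubling_term|].
      exists (2 * / INR (u n)). apply is_series_half.
    + apply is_series_unique, is_series_half.
Qed.

Lemma doubling_split n : Series (fun m => / INR (u m)) =
  sum_f_R0 (fun m => / INR (u m)) n + Series (fun m => / INR (u (S n + m)%nat)).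
Proof. apply (Series_incr_n (fun m => / INR (u m)) (S n)); [lia|apply (doubling_ex_series 0)]. Qed.

End DoublingSeries.

(** * From the given double sequence to a chain of scales *)

Section Construction.

Variables (k : nat) (q : nat -> nat -> nat).
Hypothesis k_pos : (1 <= k)%nat.
Hypothesis q_lt : forall n j, (1 <= n)%nat -> (1 <= j < k)%nat -> (q n j < q n (S j))%nat.
Hypothesis q_lt_next : forall n, (1 <= n)%nat -> (q n k < q (S n) 1)%nat.
Hypothesis q_div : forall n j, (1 <= n)%nat -> (1 <= j < k)%nat ->
  Nat.divide (q n j) (q n (S j)).
Hypothesis q_div_next : forall n, (1 <= n)%nat -> Nat.divide (q n k) (q (S n) 1%nat).

Lemma q_div_row n i j : (1 <= n)%nat -> (1 <= i <= j)%nat -> (j <= k)%nat ->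
  Nat.divide (q n i) (q n j).
Proof.
  intros Hn Hi. induction j as [|j IH]; intros Hj; [lia|].
  destruct (Nat.eq_dec i (S j)) as [->|]; [apply Nat.divide_refl|].
  eapply Nat.divide_trans; [apply IH; lia|apply q_div; lia].
Qed.

(* A zero would divide, hence equal, its strictly larger successor. *)
Lemma q_pos n j : (1 <= n)%nat -> (1 <= j <= k)%nat -> (0 < q n j)%nat.
Proof.
  intros Hn Hj. destruct (Nat.eq_dec (q n j) 0) as [E|]; [|lia].
  pose proof (q_div_row n j k Hn ltac:(lia) ltac:(lia)) as [c Hc].
  pose proof (q_div_next n Hn) as [d Hd]. pose proof (q_lt_next n Hn). nia.
Qed.

Lemma q_div_col n m i : (1 <= n <= m)%nat -> (1 <= i <= k)%nat -> Nat.divide (q n i) (q m k).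
Proof.
  intros Hn Hi. induction m as [|m IH]; [lia|].
  destruct (Nat.eq_dec n (S m)) as [->|]; [apply q_div_row; lia|].
  eapply Nat.divide_trans; [apply IH; lia|].
  eapply Nat.divide_trans; [apply q_div_next; lia|apply q_div_row; lia].
Qed.

Lemma q_le_row n i j : (1 <= n)%nat -> (1 <= i <= j)%nat -> (j <= k)%nat -> (q n i <= q n j)%nat.
Proof.
  intros Hn Hi Hj. apply Nat.divide_pos_le; [apply q_pos; lia|apply q_div_row; lia].
Qed.

(** A proper multiple is at least twice as large, which applies to [q (n+1) 1] over [q n k]. *)
Lemma q_double n i : (1 <= n)%nat -> (1 <= i <= k)%nat -> (2 * q n i <= q (S n) i)%nat.
Proof.
  intros Hn Hi. pose proof (q_lt_next n Hn). destruct (q_div_next n Hn) as [c Hc].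
  pose proof (q_le_row n i k Hn ltac:(lia) ltac:(lia)).
  pose proof (q_le_row (S n) 1 i ltac:(lia) ltac:(lia) ltac:(lia)).
  assert (2 <= c)%nat by nia. nia.
Qed.

(** Scale [n] surrounds row [n + 2] by the last entry of row [n + 1] and the first of row [n + 3],
    so that only rows of index at least 1 occur. *)
Definition scale (n i : nat) : nat :=
  match i with
  | O => q (S n) k
  | _ => if (i <=? k)%nat then q (S (S n)) i else q (S (S (S n))) 1
  end.

Lemma scale_0 n : scale n 0 = q (S n) k.
Proof. reflexivity. Qed.

Lemma scale_mid n i : (1 <= i <= k)%nat -> scale n i = q (S (S n)) i.
Proof.
  intros H. destruct i as [|i]; [lia|]. cbn [scale].
  destruct (Nat.leb_spec (S i) k); [reflexivity|lia].
Qed.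

Lemma scale_last n : scale n (S k) = q (S (S (S n))) 1.
Proof. cbn [scale]. destruct (Nat.leb_spec (S k) k); [lia|reflexivity]. Qed.

Lemma scale_pos n i : (i <= S k)%nat -> (0 < scale n i)%nat.
Proof.
  intros H. destruct (Nat.eq_dec i 0) as [->|]; [apply q_pos; lia|].
  destruct (Nat.eq_dec i (S k)) as [->|]; [rewrite scale_last|rewrite scale_mid by lia];
    apply q_pos; lia.
Qed.

Lemma scale_succ n i : (i <= k)%nat ->
  (scale n i < scale n (S i))%nat /\ Nat.divide (scale n i) (scale n (S i)).
Proof.
  intros H. destruct (Nat.eq_dec i 0) as [->|].
  - rewrite scale_0, scale_mid by lia. auto with arith.
  - rewrite (scale_mid n i) by lia. destruct (Nat.eq_dec i k) as [->|].
    + rewrite scale_last. auto with arith.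
    + rewrite scale_mid by lia. split; [apply q_lt|apply q_div]; lia.
Qed.

Definition zeta (t : nat) : R := Series (fun n => / INR (q (S n) t)).

(** The numerator of the partial sum over the rows [1, ..., n + 1] on the common denominator
    [q (n+1) k]. *)
Definition numer (n t : nat) : Z := zsum (S n) (fun m => Z.of_nat (q (S n) k / q (S m) t)).

Lemma numer_spec n t : (1 <= t <= k)%nat ->
  IZR (numer n t) / INR (q (S n) k) = sum_f_R0 (fun m => / INR (q (S m) t)) n.
Proof.
  intros Ht. pose proof (lt_0_INR _ (q_pos (S n) k ltac:(lia) ltac:(lia))) as Hr.
  assert (T : forall m, (m <= n)%nat ->
    IZR (Z.of_nat (q (S n) k / q (S m) t)) / INR (q (S n) k) = / INR (q (S m) t)).
  { intros m Hm. destruct (q_div_col (S m) (S n) t ltac:(lia) Ht) as [c Hc].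
    pose proof (q_pos (S m) t ltac:(lia) Ht) as Hp. rewrite <- INR_IZR_INZ.
    rewrite Hc in *. rewrite Nat.div_mul by lia. rewrite mult_INR in *.
    apply lt_0_INR in Hp. field. split; nra. }
  enough (G : forall i, (i <= n)%nat ->
    IZR (zsum (S i) (fun m => Z.of_nat (q (S n) k / q (S m) t))) / INR (q (S n) k)
    = sum_f_R0 (fun m => / INR (q (S m) t)) i) by (apply G; lia).
  induction i as [|i IH]; intros Hi.
  - cbn [zsum sum_f_R0]. rewrite Z.add_0_l. apply T. lia.
  - change (zsum (S (S i)) ?f) with (zsum (S i) f + f (S i))%Z. cbn beta.
    rewrite plus_IZR, Rdiv_plus_distr, IH, T by lia. reflexivity.
Qed.

Lemma zeta_tails n t : (1 <= t <= k)%nat ->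
  Rabs (zeta t - IZR (numer n t) / INR (scale n 0)) <= 2 / INR (scale n t) /\
  Rabs (zeta t - IZR (numer n t) / INR (scale n 0) - / INR (scale n t))
    <= 2 / INR (scale n (S k)).
Proof.
  intros Ht. rewrite scale_0, scale_last, scale_mid, numer_spec by lia.
  set (u := fun m => q (S m) t).
  assert (Up : forall m, (0 < u m)%nat) by (intros m; apply q_pos; lia).
  assert (Ud : forall m, (2 * u m <= u (S m))%nat) by (intros m; apply q_double; lia).
  change (zeta t) with (Series (fun m => / INR (u m))).
  change (fun m => / INR (q (S m) t)) with (fun m => / INR (u m)).
  change (q (S (S n)) t) with (u (S n)).
  pose proof (doubling_split u Up Ud n) as E1.
  pose proof (doubling_split u Up Ud (S n)) as E2. cbn [sum_f_R0] in E2.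
  pose proof (doubling_tail u Up Ud (S n)) as B1.
  pose proof (doubling_tail u Up Ud (S (S n))) as B2.
  split.
  - rewrite Rabs_pos_eq; lra.
  (* The second tail starts at [q (n+3) t], which is at least [q (n+3) 1], the last denominator of
     the scale. *)
  - assert (B3 : 2 / INR (u (S (S n))) <= 2 / INR (q (S (S (S n))) 1%nat)).
    { apply Rmult_le_compat_l; [lra|]. apply Rinv_le_contravar.
      - apply lt_0_INR, q_pos; lia.
      - apply le_INR. unfold u. apply q_le_row; lia. }
    rewrite Rabs_pos_eq; lra.
Qed.

End Construction.

Theorem theorem2p5 (k : nat) (q : nat -> nat -> nat) (eta : nat -> R) :
  (1 <= k)%nat ->
  (forall n j, (1 <= n)%nat -> (1 <= j < k)%nat -> (q n j < q n (S j))%nat) ->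
  (forall n, (1 <= n)%nat -> (q n k < q (S n) 1%nat)%nat) ->
  (forall n j, (1 <= n)%nat -> (1 <= j < k)%nat -> Nat.divide (q n j) (q n (S j))) ->
  (forall n, (1 <= n)%nat -> Nat.divide (q n k) (q (S n) 1%nat)) ->
  is_lim_seq (fun n => (ln (INR (q (S n) 1%nat)) - ln (INR (q n k)))
                         / ln (INR (q (S n) k))) (Finite (eta 1%nat)) ->
  (forall i, (2 <= i <= k)%nat ->
     is_lim_seq (fun n => (ln (INR (q (S n) i)) - ln (INR (q (S n) (pred i))))
                            / ln (INR (q (S n) k))) (Finite (eta i))) ->
  is_lim_seq (fun n => ln (INR (q (S n) 1%nat)) / ln (INR (q n k))) p_infty ->
  psum eta k = 1 ->
  0 < eta 1%nat ->
  (forall i, (1 <= i < k)%nat -> eta i <= eta (S i)) ->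
  let zeta := fun j : nat => Series (fun n => / INR (q (S n) j)) in
  omega k zeta 1%nat = p_infty /\
  (forall j, (2 <= j <= k + 1)%nat ->
     omega k zeta j =
       Finite (max_range (fun m => eta (m + 2 - j)%nat / psum eta m) (j - 1) k)) /\
  omega_hat k zeta 1%nat = Finite (min_range (fun m => eta m / psum eta m) 1 k) /\
  (forall j, (2 <= j <= k + 1)%nat -> omega_hat k zeta j = Finite 0).
Proof.
  intros Hk Hlt Hltn Hdiv Hdivn Hl1 Hli Hinf Hsum Hpos Hmono.
  apply (chain_constants k (scale k q) (numer k q)); auto.
  - intros n i Hi. apply scale_pos; auto.
  - intros n i Hi. apply scale_succ; auto.
  - intros n i Hi. apply scale_succ; auto.
  - intros n. rewrite scale_mid by lia. reflexivity.
  - intros n. rewrite scale_last, scale_mid by lia. reflexivity.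
  - intros n t Ht. apply (zeta_tails k q); auto.
  - intros n t Ht. apply (zeta_tails k q); auto.
  - intros i Hi. unfold lg. destruct (Nat.eq_dec i 1) as [->|Hne].
    (* The shift by one discards the term with row 0 and aligns row [n + 2] with scale [n]. *)
    + apply is_lim_seq_incr_1 in Hl1. eapply is_lim_seq_ext; [|exact Hl1].
      intros n. cbv beta. rewrite (scale_mid k q Hk n 1), (scale_mid k q Hk n k) by lia. reflexivity.
    + specialize (Hli i ltac:(lia)). apply is_lim_seq_incr_1 in Hli.
      eapply is_lim_seq_ext; [|exact Hli].
      intros n. cbv beta.
      rewrite (scale_mid k q Hk n i), (scale_mid k q Hk n (pred i)), (scale_mid k q Hk n k) by lia. reflexivity.
  (* The last gap of scale [n] joins the rows [n + 2] and [n + 3], hence a shift by two. *)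
  - unfold lg. do 2 apply -> is_lim_seq_incr_1 in Hinf.
    eapply is_lim_seq_ext; [|exact Hinf].
    intros n. cbv beta. rewrite scale_last, scale_mid by lia. reflexivity.
Qed.
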